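(* For every constant $a>0$ there exist constants $c,C>0$ and $n_0$, depending only on $a$, such that the following holds. Let $G$ be any $d$-regular graph with $n\ge n_0$ vertices, where $d\ge a\log n\,\log\log n$. Then the cover time $T_{\mathrm{cov}}$ of the local search allocation on $G$ satisfies $$\mathbf{Pr}\left[\,c\,n\le T_{\mathrm{cov}}\le C\,n\,\right]\ge 1-n^{-1},$$ i.e. for $d=\Omega(\log n\log\log n)$, with probability at least $1-n^{-1}$ the cover time is $\Theta(n)$.
   Context: Graphs are finite and undirected, not necessarily connected; $\log$ is the natural logarithm. Local search allocation on $G=(V,E)$: initially all vertices have load $0$. Balls $1,2,\dots$ arrive one at a time. Ball $i$ is born at a vertex $U_i$ (its birthplace) chosen independently and uniformly at random from $V$. Starting at its birthplace, in each step the ball moves to a neighbour of its current vertex having the smallest load among all neighbours, provided that this load is strictly smaller than the load of the current vertex; ties between smallest-load neighbours are broken independently and uniformly at random. The ball stops at the first vertex visited that has no neighbour of strictly smaller load, and it is allocated there, increasing that vertex's load by $1$. Then the next ball arrives. $X_v^{(m)}$ denotes the load of $v$ after $m$ balls have been allocated. The cover time is $T_{\mathrm{cov}}=\min\{m\ge 0: X_v^{(m)}\ge 1\text{ for all }v\in V\}$. *)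

(* Defs.v *)
(* Written in the MathComp / MathComp-Analysis world. *)
From HB Require Import structures.
From mathcomp Require Import all_boot all_order all_algebra.
From mathcomp Require Import all_classical all_reals all_analysis.

Set Implicit Arguments.
Unset Strict Implicit.
Unset Printing Implicit Defensive.
Import Order.TTheory GRing.Theory Num.Theory.
Local Open Scope ring_scope.
Local Open Scope classical_set_scope.

Section LocalSearch.
Context {V : finType} (e : rel V).

Definition regular (d : nat) : Prop :=
  forall v, #|[set w : V | e v w]%SET| = d.

(* Vertices to which a ball located at [v] may move under the loads [x]: the
   neighbours of smallest load, provided that load is smaller than that of [v].
   This set is empty exactly when the ball stops at [v]. *)
Definition next_vertices (x : V -> nat) (v : V) : {set V} :=
  [set w : V | [&& e v w, (x w < x v)%N &
                   [forall w', e v w' ==> (x w <= x w')%N]]]%SET.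

(* The trajectory of a ball: its birthplace, then the vertices it moves to. *)
Definition trajectory := (V * seq V)%type.

Definition birthplace (t : trajectory) : V := t.1.
Definition destination (t : trajectory) : V := last t.1 t.2.

(* [load t m v] is the load of [v] after the balls 0, ..., m-1 have followed
   the trajectories [t 0], ..., [t (m-1)]. *)
Definition load (t : nat -> trajectory) (m : nat) (v : V) : nat :=
  (\sum_(i < m) (destination (t i) == v))%N.

(* Probability that a ball located at [v] makes exactly the moves [s] and then
   stops, each move being uniform on [next_vertices]. The loads [x] do not
   change while the ball moves. *)
Fixpoint moves_prob (R : realType) (x : V -> nat) (v : V) (s : seq V) : R :=
  match s with
  | [::] => (#|next_vertices x v| == 0%N)%:R
  | w :: s' => (w \in next_vertices x v)%:R / #|next_vertices x v|%:R
               * moves_prob R x w s'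
  end.

Definition trajectory_prob (R : realType) (x : V -> nat) (t : trajectory) : R :=
  #|V|%:R^-1 * moves_prob R x (birthplace t) t.2.

(* [W i] is the random trajectory of the ball number [i] (counted from 0).
   The joint law of the trajectories is given by the chain rule: whatever the
   earlier trajectories, the birthplace of each ball is uniform on [V] and each
   of its moves is uniform among the smallest-load neighbours. As the birthplace
   factor is #|V|^-1 in all cases, the birthplaces are independent. *)
Record local_search_allocation (R : realType) (disp : measure_display)
    (Omega : measurableType disp) (P : probability Omega R)
    (W : nat -> Omega -> trajectory) : Prop := {
  measurable_trajectory : forall i t, measurable (W i @^-1` [set t]) ;
  trajectory_law : forall (m : nat) (t : nat -> trajectory),
    P [set omega | forall i, (i < m)%N -> W i omega = t i] =
    (\prod_(i < m) trajectory_prob R (load t i) (t i))%:E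
}.

(* The least [m] such that every vertex has load at least 1 after [m] balls;
   it is +oo if there is none. *)
Definition cover_time (R : realType) (t : nat -> trajectory) : \bar R :=
  ereal_inf [set (m%:R)%:E | m in [set m : nat | forall v, (1 <= load t m v)%N]].

End LocalSearch.

Arguments trajectory V : clear implicits.

(* Main.v *)
(* Call a vertex uncovered while its load is 0, and suppose every vertex has at
   most z uncovered neighbours at some time. Let S be a set of uncovered vertices
   with |S| >= z/2. If z = d, the next ball is born in S with probability at
   least d/(2n). If z <= d/2, every w in S has at least d/2 covered neighbours u,
   and a ball born at such a u moves to a uniform uncovered neighbour of u, hence
   to w with probability at least 1/z. In both cases S is hit with probability
   at least d/(4n), so it survives D steps with probability at most
   exp(-dD/(4n)). A union bound over the n 2^z candidates (u, S), with S among
   the uncovered neighbours of u at the start of the phase, shows that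
   D = (4n/d)(3 log n + z) steps halve z except with probability n^-2. The
   phases z = d, d/2, d/4, ..., 1 number about log d and last
   O(n log n log d / d + n) = O(n) steps together; when z = 0 everything is
   covered. Conversely, covering n vertices takes n balls. *)
Require Import Defs.
From mathcomp Require Import all_boot all_order all_algebra.
From mathcomp Require Import all_classical all_reals all_analysis.
From mathcomp Require Import ring lra zify.

Set Implicit Arguments.
Unset Strict Implicit.
Unset Printing Implicit Defensive.
Import Order.TTheory GRing.Theory Num.Theory.
Local Open Scope ring_scope.
Local Open Scope classical_set_scope.

(** * Union bound, and conditioning on a random variable with countably many values *)

Section Measure.
Context {R : realType} {disp : measure_display} {Omega : measurableType disp}.
Context (P : probability Omega R).

Lemma measure_bigcup_fin_le (I : finType) (D : pred I) (X : set Omega)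
    (F : I -> set Omega) :
  measurable X -> (forall i, D i -> measurable (F i)) ->
  (forall x, X x -> exists2 i, D i & F i x) ->
  (P X <= \sum_(i | D i) P (F i))%E.
Proof.
move=> mX mF XF.
have [mU PU] : measurable (\big[setU/set0]_(i | D i) F i) /\
    (P (\big[setU/set0]_(i | D i) F i) <= \sum_(i | D i) P (F i))%E.
  apply: (big_ind2 (fun A y => measurable A /\ (P A <= y)%E)).
  - by split; rewrite ?measure0.
  - move=> A a B b [mA Aa] [mB Bb]; split; first exact: measurableU.
    by apply: le_trans (measureU2 _ mA mB) _; exact: leeD.
  - by move=> i Di; split; first exact: mF.
apply: le_trans PU; apply: le_measure; rewrite ?inE// => x /XF[i Di Fx].
by rewrite (bigD1 i)//; left.
Qed.

Context {T : countType} (f : Omega -> T).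
Hypothesis fibers : forall t, measurable (f @^-1` [set t]).

Lemma measurable_preimage_fibers (D : set T) : measurable (f @^-1` D).
Proof.
rewrite (_ : f @^-1` D = \bigcup_(t in D) (f @^-1` [set t])); last first.
  by apply/seteqP; split=> [x Dx|x [t Dt /= ->]//]; exists (f x).
rewrite bigcup_mkcond; apply: countable_bigcupT_measurable => [|t].
  exact: countableP.
by case: ifP.
Qed.

(** The fibers of [f] cut the space into countably many measurable pieces, over which the
    inequalities add up. This stands in for conditional probabilities and treats pieces of measure
    zero like all others. *)
Lemma fiberwise_le (c : R) (A B : set Omega) :
  measurable A -> measurable B ->
  (forall omega0, (P (B `&` [set omega | f omega = f omega0]) <=
                   c%:E * P (A `&` [set omega | f omega = f omega0]))%E) ->
  (P B <= c%:E * P A)%E.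
Proof.
move=> mA mB AB.
(* Codes in [nat] make the partition a sequence; codes outside the range of [f] give empty
   pieces. *)
pose F (k : nat) : set Omega := [set omega | pickle (f omega) = k].
have mF k : measurable (F k).
  exact: (measurable_preimage_fibers [set t | pickle t = k]).
have split_fibers (D : set Omega) : measurable D ->
    P D = (\sum_(k <oo) P (D `&` F k))%E.
  move=> mD; rewrite {1}(_ : D = \bigcup_k (D `&` F k)); last first.
    by apply/seteqP; split=> [x Dx|x [k _ []]//]; exists (pickle (f x)).
  rewrite measure_bigcup//.
  - by apply: eq_eseriesl => k; rewrite in_setT.
  - by move=> k _; apply: measurableI.
  - by move=> i j _ _ [x [[_ <-] [_ <-]]].
rewrite (split_fibers A mA) (split_fibers B mB) -nneseriesZl//.
apply: lee_nneseries => [//|k _].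
have [->|/set0P[omega0 Fk]] := eqVneq (F k) set0.
  by rewrite !setI0 measure0 mule0.
have -> : F k = [set omega | f omega = f omega0].
  apply/seteqP; split=> x /=; rewrite /F/= -Fk; last by move=> ->.
  exact: (pcan_inj pickleK).
exact: AB.
Qed.
End Measure.

(** * Loads as functions of the trajectories *)

Section Load.
Context {V : finType}.
Implicit Types t : nat -> trajectory V.

Lemma load_ext t t' m :
  (forall i, (i < m)%N -> t i = t' i) -> load t m = load t' m.
Proof. by move=> tt'; apply/funext => v; apply: eq_bigr => i _; rewrite tt'. Qed.

Lemma load_le t m k v : (m <= k)%N ->
  (load t m v <= load t k v)%N.
Proof.
move=> /subnK <-; elim: (k - m)%N => [//|j IHj].
by rewrite addSn /load big_ord_recr/=; apply: leq_trans IHj (leq_addr _ _).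
Qed.

End Load.

(** * Law of a single ball under fixed loads *)

Section NextBall.
Context {R : realType} {V : finType} (e : rel V) (d : nat) (x : V -> nat).
Hypotheses (e_sym : symmetric e) (e_reg : regular e d).

Lemma birth_prob v : x v = 0%N ->
  trajectory_prob e R x (v, [::]) = #|V|%:R^-1.
Proof.
move=> xv0; rewrite /trajectory_prob/= (_ : next_vertices e x v = finset.set0).
  by rewrite cards0 eqxx mulr1.
by apply/setP => w; rewrite !inE xv0 ltn0 andbF.
Qed.

(** The neighbour [w] makes 0 the smallest load around [u], so the ball chooses among the uncovered
    neighbours of [u]; at [w] it stops, as no load is below 0. *)
Lemma move_prob u w : (0 < x u)%N -> e u w -> x w = 0%N ->
  trajectory_prob e R x (u, [:: w]) =
  #|V|%:R^-1 * #|[set v | e u v & x v == 0%N]%SET|%:R^-1.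
Proof.
move=> xu uw xw; rewrite /trajectory_prob/=.
have -> : next_vertices e x u = [set v | e u v & x v == 0%N]%SET.
  apply/setP => v; rewrite !inE; apply: andb_id2l => uv.
  apply/andP/eqP => [[_ /forallP/(_ w)]|xv].
    by rewrite uw xw leqn0 => /eqP.
  by rewrite xv; split=> //; apply/forallP => v'; rewrite leq0n implybT.
have -> : next_vertices e x w = finset.set0.
  by apply/setP => v; rewrite !inE xw ltn0 andbF.
by rewrite cards0 eqxx inE uw xw eqxx mulr1 mul1r.
Qed.

(* If [z = d], count the balls born in [S]; otherwise at least half of the
   neighbours [u] of each [w] in [S] are covered, and a ball born at such a [u]
   moves to [w] with probability at least [1 / z]. *)
Lemma hitting_prob (S : {set V}) (z : nat) :
  (0 < d)%N ->
  S \subset [set v | x v == 0%N]%SET -> S != finset.set0 ->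
  (z <= 2 * #|S|)%N ->
  (forall u, #|[set v | e u v & x v == 0%N]%SET| <= z)%N ->
  z = d \/ (2 * z <= d)%N ->
  exists L : seq (trajectory V),
    [/\ uniq (L : seq (V * seq V)),
        forall t, (t : V * seq V) \in (L : seq (V * seq V)) -> destination t \in S &
        d%:R / (4 * #|V|%:R) <= \sum_(t <- L) trajectory_prob e R x t].
Proof.
move=> d0 SU S0 zS Zz zd.
have xS v : v \in S -> x v = 0%N by move=> /(fintype.subsetP SU); rewrite inE => /eqP.
have n0 : (0 : R) < #|V|%:R.
  case/set0Pn : S0 => w _; rewrite ltr0n; apply/card_gt0P; by exists w.
case: zd => [zd|zd].
  exists [seq (w, [::]) | w <- enum S]; split.
  - by rewrite map_inj_uniq ?enum_uniq// => v w [].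
  - by move=> t /mapP[w]; rewrite mem_enum => wS ->.
  - rewrite big_map big_enum/= (eq_bigr (fun=> #|V|%:R^-1)) => [|w wS]; last first.
      by rewrite birth_prob ?xS.
    rewrite sumr_const -[leRHS]mulr_natl invfM mulrA ler_pM2r ?invr_gt0//.
    have : z%:R <= 2 * #|S|%:R :> R by rewrite -natrM ler_nat.
    have : (0 : R) <= #|S|%:R by [].
    rewrite zd => ? ?; lra.
(* A pair [(w, u)] stands for the ball born at the covered vertex [u] that moves to [w] in [S]. *)
pose D := [pred p : V * V | (p.1 \in S) && (e p.2 p.1 && (0 < x p.2)%N)].
exists [seq (p.2, [:: p.1]) | p <- enum D]; split.
- by rewrite map_inj_uniq ?enum_uniq// => -[v w] [v' w'] /= [-> ->].
- by move=> t /mapP[[w u]]; rewrite mem_enum => /andP[wS _] ->.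
(* A vertex [w] of [S] has a neighbour because [d > 0], and is itself an uncovered neighbour of
   it. *)
- have z0 : (0 : R) < z%:R.
    case/set0Pn : S0 => w wS.
    have [u /[!inE] wu] : exists u, u \in [set u | e w u]%SET.
      by apply/card_gt0P; rewrite e_reg.
    rewrite ltr0n; apply: leq_trans (Zz u); apply/card_gt0P; exists w.
    by rewrite inE e_sym wu xS.
  rewrite big_map big_enum/=.
  apply: (@le_trans _ _ (\sum_(p | D p) (#|V|%:R^-1 * z%:R^-1))); last first.
    apply: ler_sum => -[w u] /andP[/= wS /andP[uw xu]].
    rewrite (move_prob xu uw (xS w wS)) ler_pM2l ?invr_gt0// lef_pV2 ?posrE ?ler_nat//.
    rewrite ltr0n; apply/card_gt0P; exists w.
    by rewrite inE uw xS.
  rewrite (_ : \sum_(p | D p) _ = \sum_(w in S)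
      \sum_(u | e u w && (0 < x u)%N) (#|V|%:R^-1 * z%:R^-1)); last first.
    by rewrite pair_big_dep.
  (* Each [w] has at least [d - z >= d / 2] covered neighbours. *)
  apply: (@le_trans _ _ (\sum_(w in S) ((d%:R / 2) * (#|V|%:R^-1 * z%:R^-1)))); last first.
    apply: ler_sum => w wS; rewrite sumr_const -[leRHS]mulr_natl.
    rewrite ler_pM2r ?mulr_gt0 ?invr_gt0// ler_pdivrMr// -natrM ler_nat.
    have := e_reg w; rewrite -(cardsID [set v | x v == 0%N]%SET).
    have -> : [set w0 | e w w0]%SET :&: [set v | x v == 0%N]%SET = [set v | e w v & x v == 0%N]%SET.
      by apply/setP => v; rewrite !inE.
    have -> : #|[set w0 | e w w0]%SET :\: [set v | x v == 0%N]%SET| =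
        #|(fun i => e i w && (0 < x i)%N)|.
      by apply: eq_card => v; rewrite !inE e_sym andbC -lt0n.
    move=> dE; apply: (@leq_trans ((d - z) * 2)); first lia.
    by rewrite leq_mul2r/= leq_subLR -dE leq_add2r Zz.
  rewrite sumr_const -[leRHS]mulr_natl !invfM.
  have -> : #|S|%:R * (d%:R / 2 * (#|V|%:R^-1 / z%:R)) =
      #|S|%:R / z%:R * 2 * (d%:R * (4^-1 / #|V|%:R)) :> R.
    by field; rewrite (gt_eqF z0) (gt_eqF n0).
  rewrite ler_peMl ?mulr_ge0 ?invr_ge0 ?(ltW n0)//.
  rewrite mulrAC ler_pdivlMr// mul1r mulrC -natrM ler_nat //.
Qed.
End NextBall.

(** * Histories and the law of the next ball *)

Section Process.
Context {R : realType} {disp : measure_display} {Omega : measurableType disp}.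
Context (P : probability Omega R) {V : finType} (e : rel V) (d : nat).
Context (W : nat -> Omega -> trajectory V).
Hypothesis alloc : local_search_allocation e P W.

Definition history (m : nat) (omega : Omega) : seq (V * seq V) :=
  mkseq (W^~ omega) m.

Lemma history_eqP m omega omega0 :
  history m omega = history m omega0 <->
  forall i, (i < m)%N -> W i omega = W i omega0.
Proof.
split=> [h i im|h].
  have := congr1 (fun s => nth (W i omega) s i) h.
  by rewrite !nth_mkseq.
apply/eq_in_map => i; rewrite mem_iota => /andP[_ im]; exact: h.
Qed.

Lemma history_le m k omega omega0 : (k <= m)%N ->
  history m omega = history m omega0 -> history k omega = history k omega0.
Proof.
move=> km /history_eqP h; apply/history_eqP => i ik; apply: h.
exact: leq_trans ik km.
Qed.

Lemma measurable_history m h : measurable (history m @^-1` [set h]).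
Proof.
elim: m h => [|m IHm] h.
  have [->|/eqP h0] := eqVneq h [::].
    rewrite (_ : _ @^-1` _ = setT)//.
    by apply/seteqP; split.
  rewrite (_ : _ @^-1` _ = set0)//.
  by apply/seteqP; split=> // x /= /esym.
case/lastP: h => [|h t].
  rewrite (_ : _ @^-1` _ = set0)//.
  by apply/seteqP; split=> // x /= /(congr1 size); rewrite size_mkseq.
rewrite (_ : _ @^-1` _ = history m @^-1` [set h] `&` W m @^-1` [set t]).
  by apply: measurableI => //; exact: measurable_trajectory alloc m t.
apply/seteqP; split=> x /=; rewrite /history mkseqS.
  by move=> /rcons_inj[-> ->].
by move=> [-> ->].
Qed.

(** Such an event is the preimage of a set of histories, and histories range over a countable
    type. *)
Lemma measurable_of_history m (A : set Omega) :
  (forall omega omega0, history m omega = history m omega0 ->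
     A omega -> A omega0) ->
  measurable A.
Proof.
move=> HA.
rewrite (_ : A = history m @^-1` (history m @` A)).
  exact: measurable_preimage_fibers (@measurable_history m) _.
apply/seteqP; split=> x /=; first by move=> Ax; exists x.
by move=> [y Ay /HA]; exact.
Qed.

Definition uncovered (m : nat) (omega : Omega) : {set V} :=
  [set v | load (W^~ omega) m v == 0%N]%SET.

Lemma uncovered_ext m omega omega0 :
  history m omega = history m omega0 -> uncovered m omega = uncovered m omega0.
Proof.
move=> /history_eqP h; apply/setP => v; rewrite !inE.
by rewrite (load_ext h).
Qed.

Lemma trajectory_prob_ge0 x (t : trajectory V) : 0 <= trajectory_prob e R x t.
Proof.
rewrite /trajectory_prob mulr_ge0 ?invr_ge0 ?ler0n//.
elim: (t.2) (birthplace t) => [|w s IHs] v /=; first exact: ler0n.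
by rewrite mulr_ge0 ?mulr_ge0 ?invr_ge0 ?ler0n.
Qed.

(** The chain rule for [m.+1] balls has one more factor than that for [m] balls. The product form
    also makes sense for histories of probability 0. *)
Lemma next_trajectory_law m omega0 t :
  P ([set omega | history m omega = history m omega0] `&`
     [set omega | W m omega = t]) =
  (P [set omega | history m omega = history m omega0] *
   (trajectory_prob e R (load (W^~ omega0) m) t)%:E)%E.
Proof.
(* The past of [omega0], followed by [t] as ball [m]. *)
pose t' i := if (i < m)%N then W i omega0 else t.
have t'm : t' m = t by rewrite /t' ltnn.
rewrite (_ : _ `&` _ = [set omega | forall i, (i < m.+1)%N -> W i omega = t' i]).
  rewrite (trajectory_law alloc) big_ord_recr/= EFinM.
  rewrite t'm (@load_ext _ t' (W^~ omega0)); last by move=> i im; rewrite /t' im.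
  congr (_ * _)%E.
  rewrite (_ : [set _ | _] = [set omega | forall i, (i < m)%N -> W i omega = W i omega0]).
    rewrite (trajectory_law alloc); congr (_%:E).
    apply: eq_bigr => i _; rewrite /t' ltn_ord.
    rewrite (@load_ext _ _ (W^~ omega0))// => j ji.
    by rewrite (ltn_trans ji).
  by apply/seteqP; split=> x /= /history_eqP.
apply/seteqP; split=> x /=.
  move=> [/history_eqP h Wt] i; rewrite ltnS leq_eqVlt => /orP[/eqP->|im].
    by rewrite t'm.
  by rewrite /t' im h.
move=> h; split; last by rewrite h// t'm.
by apply/history_eqP => i im; rewrite h ?(ltn_trans im)// /t' im.
Qed.

Lemma next_trajectory_in_law m omega0 (L : seq (trajectory V)) : uniq (L : seq (V * seq V)) ->
  P ([set omega | history m omega = history m omega0] `&`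
     [set omega | (W m omega : V * seq V) \in (L : seq (V * seq V))]) =
  (P [set omega | history m omega = history m omega0] *
   (\sum_(t <- L) trajectory_prob e R (load (W^~ omega0) m) t)%:E)%E.
Proof.
elim: L => [_|t L IHL].
  rewrite big_nil mule0 (_ : _ `&` _ = set0) ?measure0//.
  by apply/seteqP; split=> // x [].
rewrite cons_uniq => /andP[tL uL]; rewrite big_cons EFinD.
rewrite ge0_muleDr ?lee_fin ?sumr_ge0//; first last.
- by move=> i _; exact: trajectory_prob_ge0.
- exact: trajectory_prob_ge0.
rewrite -next_trajectory_law -IHL// -measureU.
- congr (P _); apply/seteqP; split=> x /=; rewrite inE.
    by move=> [h /orP[/eqP|]]; [left|right].
  by move=> [[h /eqP->]//|[h ->]]; rewrite orbT.
- apply: (@measurable_of_history m.+1) => x y xy/=.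
  by rewrite -(history_le (leqnSn m) xy) -((history_eqP _ _ _).1 xy m (ltnSn m)).
- apply: (@measurable_of_history m.+1) => x y xy/=.
  by rewrite -(history_le (leqnSn m) xy) -((history_eqP _ _ _).1 xy m (ltnSn m)).
- by apply/seteqP; split=> // x [[_ /= ->] [_ /=]]; apply/negP.
Qed.

(** Landing outside [S] and following a trajectory of [L] are disjoint events, and given the history
    the latter has probability at least [p]. *)
Lemma next_ball_avoids m omega0 (S : {set V}) (L : seq (trajectory V)) (p : R) :
  uniq (L : seq (V * seq V)) ->
  (forall t, (t : V * seq V) \in (L : seq (V * seq V)) -> destination t \in S) ->
  p <= \sum_(t <- L) trajectory_prob e R (load (W^~ omega0) m) t ->
  (P ([set omega | destination (W m omega) \notin S] `&`
      [set omega | history m omega = history m omega0]) <=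
   (1 - p)%:E * P [set omega | history m omega = history m omega0])%E.
Proof.
move=> uL LS pL.
set H := [set omega | history m omega = history m omega0].
set A := [set omega | _ \notin _].
set B := [set omega | (W m omega : V * seq V) \in (L : seq (V * seq V))].
have mH : measurable H.
  by apply: (@measurable_of_history m) => x y xy/=; rewrite /H/= -xy.
have mA : measurable A.
  apply: (@measurable_of_history m.+1) => x y xy; rewrite /A/=.
  by rewrite -((history_eqP _ _ _).1 xy m (ltnSn m)).
have mB : measurable B.
  apply: (@measurable_of_history m.+1) => x y xy; rewrite /B/=.
  by rewrite -((history_eqP _ _ _).1 xy m (ltnSn m)).
have PHfin : P H \is a fin_num by exact: fin_num_measure.
have : (P (A `&` H) + P (H `&` B) <= P H)%E.
  rewrite -measureU; [|exact: measurableI|exact: measurableI|].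
    apply: le_measure; rewrite ?inE//; last by move=> x [[]|[]].
    by apply: measurableU; exact: measurableI.
  apply/seteqP; split=> // x [[/= /negP Ax _] [_ /= Bx]].
  by apply: Ax; exact: LS.
rewrite next_trajectory_in_law// -/H.
have PAHfin : P (A `&` H) \is a fin_num.
  by apply: fin_num_measure; exact: measurableI.
move: (measure_ge0 P H).
rewrite -(fineK PHfin) -(fineK PAHfin) -!EFinM -EFinD !lee_fin => PH0 le_PH.
rewrite mulrBl mul1r lerBrDr; apply: le_trans le_PH.
by rewrite lerD2l mulrC ler_wpM2l ?fine_ge0.
Qed.

(** * Halving of the uncovered neighbourhoods, phase by phase *)

Hypotheses (e_sym : symmetric e) (e_reg : regular e d) (d_gt0 : (0 < d)%N).

Lemma uncovered_le m k omega : (m <= k)%N ->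
  uncovered k omega \subset uncovered m omega.
Proof.
move=> mk; apply/fintype.subsetP => v; rewrite !inE -!leqn0.
exact: leq_trans (load_le _ _ mk).
Qed.

Definition uncovered_nbrs (m : nat) (omega : Omega) (u : V) : {set V} :=
  [set v | e u v & load (W^~ omega) m v == 0%N]%SET.

Lemma uncovered_nbrs_le m k omega u : (m <= k)%N ->
  uncovered_nbrs k omega u \subset uncovered_nbrs m omega u.
Proof.
move=> /(@uncovered_le _ _ omega)/fintype.subsetP U; apply/fintype.subsetP => v.
by have := U v; rewrite !inE => {}U /andP[-> /U].
Qed.

Lemma uncovered_nbrs_ext m omega omega0 u :
  history m omega = history m omega0 ->
  uncovered_nbrs m omega u = uncovered_nbrs m omega0 u.
Proof.
move=> /history_eqP h; apply/setP => v; rewrite !inE.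
by rewrite (load_ext h).
Qed.

Definition few_uncovered (z m : nat) : set Omega :=
  [set omega | forall u, (#|uncovered_nbrs m omega u| <= z)%N].

Lemma measurable_few_uncovered z m : measurable (few_uncovered z m).
Proof.
apply: (@measurable_of_history m) => x y xy h u.
by rewrite -(uncovered_nbrs_ext u xy).
Qed.

Let p : R := d%:R / (4 * #|V|%:R).

Lemma regular_le_card : (d <= #|V|)%N \/ #|V| = 0%N.
Proof.
have [->|/card_gt0P[v _]] := posnP #|V|; [by right|left].
by rewrite -(e_reg v) max_card.
Qed.

Lemma hit_rate_le1 : p <= 1.
Proof.
(* On the empty graph, inversion of 0 gives [p = 0]. *)
rewrite /p; case: regular_le_card => [dV|->]; last by rewrite mulr0 invr0 mulr0.
have V0 : (0 : R) < #|V|%:R by rewrite ltr0n (leq_trans d_gt0).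
rewrite ler_pdivrMr ?mulr_gt0// mul1r -natrM ler_nat.
by rewrite (leq_trans dV)// leq_pmull.
Qed.

(** Induction on [j], conditioning on the first [T + j] balls: while [S] survives, [hitting_prob]
    applies with the same [z], since uncovered neighbourhoods only shrink. Fixing the history up to
    [T] allows [S] to depend on it. *)
Lemma survival_prob T j z omega0 (S : {set V}) :
  S \subset uncovered T omega0 -> S != finset.set0 -> (z <= 2 * #|S|)%N ->
  few_uncovered z T omega0 -> z = d \/ (2 * z <= d)%N ->
  (P ([set omega | S \subset uncovered (T + j) omega] `&`
      [set omega | history T omega = history T omega0]) <=
   ((1 - p) ^+ j)%:E * P [set omega | history T omega = history T omega0])%E.
Proof.
move=> SU S0 zS fewT zd; have p1 := hit_rate_le1.
have mH : measurable [set omega | history T omega = history T omega0].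
  by apply: (@measurable_of_history T) => x y xy/=; rewrite -xy.
have mSU k : measurable [set omega | S \subset uncovered k omega].
  by apply: (@measurable_of_history k) => x y xy/=; rewrite (uncovered_ext xy).
elim: j => [|j IHj].
  rewrite mul1e; apply: le_measure; rewrite ?inE//; last exact: measurableI.
rewrite exprS EFinM -muleA.
apply: le_trans (lee_wpmul2l _ IHj); last by rewrite lee_fin subr_ge0.
apply: (fiberwise_le (@measurable_history (T + j)));
  [exact: measurableI|exact: measurableI|move=> omega1].
(* If [S] is already hit under [omega1], or its first [T] balls differ from those of [omega0], the
   event on the left is empty on this fiber. *)
have [[SU1 H1]|nA] := pselect (([set omega | S \subset uncovered (T + j) omega] `&`
      [set omega | history T omega = history T omega0]) omega1); last first.
  rewrite (_ : _ `&` _ = set0).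
    by rewrite measure0 mule_ge0// lee_fin subr_ge0.
  apply/seteqP; split=> // x [[/= SUx Hx] xomega1]; apply: nA; split=> /=.
    rewrite -(uncovered_ext xomega1).
    by apply: (fintype.subset_trans SUx); apply: uncovered_le; rewrite addnS.
  by rewrite -(history_le (leq_addr j T) xomega1).
have -> : [set omega | S \subset uncovered (T + j) omega] `&`
      [set omega | history T omega = history T omega0] `&`
      [set omega | history (T + j) omega = history (T + j) omega1] =
      [set omega | history (T + j) omega = history (T + j) omega1].
  apply/seteqP; split=> x /=; first by case.
  move=> xomega1; split=> //; split; first by rewrite (uncovered_ext xomega1).
  by rewrite (history_le (leq_addr j T) xomega1).
have [|L [uL LS pL]] := @hitting_prob R V e d (load (W^~ omega1) (T + j))
  e_sym e_reg S z d_gt0 SU1 S0 zS _ zd.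
  move=> u; apply: leq_trans (fewT u).
  rewrite -(uncovered_nbrs_ext u H1); apply: subset_leq_card.
  by apply: uncovered_nbrs_le; exact: leq_addr.
apply: le_trans (next_ball_avoids uL LS pL).
apply: le_measure; rewrite ?inE.
- apply: measurableI; first exact: measurableI.
  by apply: (@measurable_of_history (T + j)) => x y xy/=; rewrite -xy.
- apply: (@measurable_of_history (T + j).+1) => x y xy/=.
  by rewrite -(history_le (leqnSn _) xy) -((history_eqP _ _ _).1 xy _ (ltnSn _)).
(* A ball landing in [S] would cover a vertex of [S]. *)
- move=> x [[/= /fintype.subsetP SUx _] ?]; split=> //=; apply/negP => /SUx.
  by rewrite inE addnS /load big_ord_recr/= eqxx addn1.
Qed.

(** Once the history up to [T] is fixed, so are the uncovered neighbourhoods, and each vertex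
    contributes at most [2 ^ z] candidate sets. On failure, the neighbours of some [u] that are
    still uncovered form a candidate that survived. *)
Lemma phase_failure T j z : z = d \/ (2 * z <= d)%N ->
  (P (few_uncovered z T `&` ~` few_uncovered z./2 (T + j)) <=
   (#|V|%:R * 2 ^+ z * (1 - p) ^+ j)%:E)%E.
Proof.
move=> zd; have p1 := hit_rate_le1.
have q0 : 0 <= (1 - p) ^+ j by rewrite exprn_ge0 ?subr_ge0.
(* The sure event is the reference event for [fiberwise_le]. *)
rewrite -[leRHS]mule1 -(probability_setT P).
have mB : measurable (few_uncovered z T `&` ~` few_uncovered z./2 (T + j)).
  by apply: measurableI; [|apply: measurableC]; exact: measurable_few_uncovered.
apply: (fiberwise_le (@measurable_history T)) => // omega0.
set H := [set omega | _ = history T omega0].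
have mH : measurable H.
  by apply: (@measurable_of_history T) => x y xy; rewrite /H/= -xy.
have [few0|nfew] := pselect (few_uncovered z T omega0); last first.
  rewrite (_ : _ `&` H = set0).
    by rewrite measure0 mule_ge0// lee_fin !mulr_ge0.
  apply/seteqP; split=> // x [[few _] xomega0]; apply: nfew => u.
  by rewrite -(uncovered_nbrs_ext u xomega0).
pose D := [pred uS : V * {set V} |
  [&& uS.2 \subset uncovered_nbrs T omega0 uS.1, uS.2 != finset.set0 & z <= 2 * #|uS.2|]%N].
rewrite setTI.
have mF (S : {set V}) : measurable ([set omega | S \subset uncovered (T + j) omega] `&` H).
  apply: measurableI => //.
  by apply: (@measurable_of_history (T + j)) => x y xy/=; rewrite (uncovered_ext xy).
have := @measure_bigcup_fin_le _ _ _ P _ D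
  (few_uncovered z T `&` ~` few_uncovered z./2 (T + j) `&` H)
  (fun uS => [set omega | uS.2 \subset uncovered (T + j) omega] `&` H).
move=> /(_ _ _ _)/le_trans; apply.
- exact: measurableI.
- by move=> uS _; exact: mF.
- move=> x [[few /existsNP[u /negP zu]] xomega0]; rewrite -ltnNge in zu.
  exists (u, uncovered_nbrs (T + j) x u) => /=.
    apply/and3P; split=> /=.
    + rewrite -(uncovered_nbrs_ext u xomega0).
      by apply: uncovered_nbrs_le; exact: leq_addr.
    + by rewrite -card_gt0; apply: leq_trans zu.
    (* More than [z./2] vertices amount to at least [z / 2], for either parity of [z]. *)
    + by move: zu; rewrite -[in X in _ -> X](odd_double_half z); lia.
  split=> //=; apply/fintype.subsetP => v; by rewrite !inE => /andP[].
apply: le_trans (_ : \sum_(uS | D uS) (((1 - p) ^+ j)%:E * P H) <= _)%E.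
  apply: lee_sum => -[u S] /and3P[/= SU S0 zS].
  apply: survival_prob (few0) zd => //.
  apply: (fintype.subset_trans SU); apply/fintype.subsetP => v; by rewrite !inE => /andP[].
rewrite -ge0_sume_distrl; last by move=> *; rewrite lee_fin.
rewrite lee_wpmul2r// sumEFin lee_fin sumr_const -[leLHS]mulr_natl ler_wpM2r//.
rewrite -natrX -natrM ler_nat.
have -> : #|D| = (\sum_(u : V) \sum_(S : {set V} | D (u, S)) 1)%N.
  by rewrite pair_big_dep/= -sum1_card; apply: eq_bigl => -[].
rewrite -sum_nat_const leq_sum// => u _; rewrite sum1_card.
apply: (@leq_trans #|finset.powerset (uncovered_nbrs T omega0 u)|).
  by apply: subset_leq_card; apply/fintype.subsetP => S /and3P[SU _ _]; rewrite inE.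
by rewrite card_powerset leq_exp2l.
Qed.

Lemma phases_failure (Delta : nat -> nat) K :
  (P (~` few_uncovered (d %/ 2 ^ K) (\sum_(k < K) Delta k)) <=
   (\sum_(k < K) (#|V|%:R * 2 ^+ (d %/ 2 ^ k) * (1 - p) ^+ Delta k))%:E)%E.
Proof.
elim: K => [|K IHK].
  rewrite !big_ord0 (_ : ~` _ = set0) ?measure0//.
  (* With threshold [d] at time 0, regularity rules out failure. *)
  apply/seteqP; split=> // x /=; apply => u; rewrite divn1 -(e_reg u).
  by apply: subset_leq_card; apply/fintype.subsetP => v; rewrite !inE => /andP[].
rewrite !big_ord_recr/=.
have halve : (d %/ 2 ^ K.+1 = (d %/ 2 ^ K)./2)%N by rewrite expnSr divnMA divn2.
(* The first phase starts at [d], every later one at [d / 2] or below. *)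
have zd : (d %/ 2 ^ K)%N = d \/ (2 * (d %/ 2 ^ K) <= d)%N.
  case: K {IHK halve} => [|K]; [by left; rewrite divn1|right].
  rewrite expnS mulnC -leq_divRL// leq_div2l// -{1}[2%N]muln1 leq_mul2l.
  by rewrite expn_gt0.
rewrite EFinD halve; apply: le_trans (leeD IHK (phase_failure (\sum_(k < K) Delta k) _ zd)).
have m k : measurable (few_uncovered (d %/ 2 ^ K) k) by exact: measurable_few_uncovered.
have m' k : measurable (few_uncovered (d %/ 2 ^ K)./2 k) by exact: measurable_few_uncovered.
apply: le_trans (measureU2 _ _ _).
- apply: le_measure; rewrite ?inE//; first exact: measurableC.
    by apply: measurableU; [exact: measurableC|apply: measurableI => //; exact: measurableC].
  (* A failure after [K.+1] phases was present after [K] of them or arises in the last one. *)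
  move=> x nx; have [?|?] := pselect (few_uncovered (d %/ 2 ^ K) (\sum_(k < K) Delta k) x).
    by right.
  by left.
- exact: measurableC.
- by apply: measurableI => //; exact: measurableC.
Qed.
End Process.

(** * Phase lengths and their sum *)

Section Estimates.
Context {R : realType}.
Implicit Types N D a : R.

(** The factor [4 * N / D] is the inverse hitting rate; [z] pays for the [2 ^ z] subsets, and
    [3 * ln N] for the [N] vertices and the error [N ^- 2]. The successor turns truncation into
    rounding up. *)
Definition phase_length N D (z : nat) : nat :=
  (Num.truncn (4 * N / D * (3 * ln N + z%:R))).+1.

(** Uses [1 - p <= expR (- p)] and [2 <= expR 1]. *)
Lemma phase_length_bound N D z : 0 < N -> 0 < D -> D / (4 * N) <= 1 ->
  N * 2 ^+ z * (1 - D / (4 * N)) ^+ phase_length N D z <= (N ^+ 2)^-1.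
Proof.
move=> N0 D0 p1; set p := D / (4 * N); set L := phase_length N D z.
have pL : 3 * ln N + z%:R <= L%:R * p.
  have := ltW (truncnS_gt (4 * N / D * (3 * ln N + z%:R))).
  rewrite -/(phase_length N D z) -/L => h.
  rewrite [leRHS]mulrC; apply: le_trans (ler_wpM2l _ h); last first.
    by rewrite divr_ge0 ?mulr_ge0 ?ltW.
  rewrite (_ : p * _ = 3 * ln N + z%:R)// /p; field.
  by rewrite (gt_eqF N0) (gt_eqF D0).
have h1 : (1 - p) ^+ L <= expR (- (3 * ln N + z%:R)).
  apply: (@le_trans _ _ (expR (- p) ^+ L)).
    by rewrite lerXn2r ?nnegrE ?subr_ge0 ?expR_ge0// expR_ge1Dx.
  by rewrite -expRM_natl ler_expR mulrN lerN2.
have h2 : (2 : R) ^+ z <= expR z%:R.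
  rewrite -[z%:R]mulr1 expRM_natl lerXn2r ?nnegrE ?expR_ge0//.
  exact: (expR_ge1Dx (1 : R)).
have h3 : 2 ^+ z * (1 - p) ^+ L <= expR z%:R * expR (- (3 * ln N + z%:R)).
  by apply: ler_pM => //; rewrite exprn_ge0 // subr_ge0.
rewrite -mulrA; apply: le_trans (ler_wpM2l (ltW N0) h3) _.
rewrite -expRD opprD addrCA subrr addr0 expRN.
rewrite expRM_natl lnK ?posrE// exprS invfM mulrA divff ?gt_eqF// mul1r//.
Qed.

(** A geometric series with rounding; the extra term makes the induction close. *)
Lemma sum_halvings d K : (\sum_(k < K) d %/ 2 ^ k + 2 * (d %/ 2 ^ K) <= 2 * d)%N.
Proof.
elim: K => [|K IHK]; first by rewrite big_ord0 divn1.
rewrite big_ord_recr/= expnSr divnMA.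
move: IHK; set s := (\sum_(k < K) _)%N; move: s (d %/ 2 ^ K)%N => s q; lia.
Qed.

Lemma log2_halvings_le (d : nat) : (0 < d)%N ->
  (trunc_log 2 d).+1%:R <= 1 + 2 * ln d%:R :> R.
Proof.
move=> d0; rewrite -natr1 addrC lerD2l.
have h : (2 : R) ^+ trunc_log 2 d <= d%:R.
  by rewrite -natrX ler_nat trunc_logP.
(* In other words [1 / ln 2 <= 2]; it comes from [1 - 1 / 2 <= expR (- (1 / 2))]. *)
have e2 : expR (2^-1 : R) <= 2.
  have := expR_ge1Dx (- 2^-1 : R); rewrite expRN => h2.
  rewrite -[leRHS]invrK -[leLHS]invrK lef_pV2 ?posrE ?invr_gt0 ?expR_gt0//.
  lra.
have : expR (2^-1 : R) ^+ trunc_log 2 d <= d%:R.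
  by apply: le_trans h; rewrite lerXn2r ?nnegrE ?expR_ge0.
rewrite -expRM_natl -[d%:R in X in X -> _]lnK ?posrE ?ltr0n// ler_expR.
lra.
Qed.

(* [d >= L^2] leaves room for the trivial bound [ln d <= 2 sqrt d]; for smaller
   [d] one has [ln d <= 2 ln L], and the lower bound on [d] applies. *)
Lemma log_phases_le a L (d : nat) : 0 < a -> 1 <= ln L -> 1 <= L -> (0 < d)%N ->
  a * L * ln L <= d%:R ->
  (trunc_log 2 d).+1%:R * L <= (5 + 5 / a) * d%:R.
Proof.
move=> a0 lnL1 L1 d0 dL.
have K := log2_halvings_le d0.
have D1 : (1 : R) <= d%:R by rewrite ler1n.
have D0 : (0 : R) < d%:R by rewrite ltr0n.
have a5 : 0 <= 5 / a * d%:R by rewrite !mulr_ge0 ?invr_ge0 ?ltW.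
have [dL2|dL2] := lerP (L ^+ 2) d%:R.
  pose s := Num.sqrt (d%:R : R).
  have ss : s ^+ 2 = d%:R by rewrite sqr_sqrtr.
  have s0 : 0 <= s by exact: sqrtr_ge0.
  have s1 : 1 <= s by rewrite -(@ler_pXn2r _ 2)// ?nnegrE// ss expr1n.
  have Ls : L <= s by rewrite -(@ler_pXn2r _ 2)// ?nnegrE// ?ss// (le_trans ler01).
  have lns : ln s <= s by have := ln_sublinear (lt_le_trans ltr01 s1); lra.
  have lnd : ln (d%:R : R) = 2 * ln s by rewrite -ss lnXn ?(lt_le_trans ltr01)// mulr_natl.
  (* Here [1 + 2 * ln d = 1 + 4 * ln s <= 5 * s], and [L <= s]. *)
  rewrite mulrDl; apply: (@le_trans _ _ (5 * s * s)); last first.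
    by rewrite -mulrA -expr2 ss lerDl.
  apply: ler_pM => //; lra.
have lnd : ln (d%:R : R) <= 2 * ln L.
  rewrite mulr_natl -lnXn ?(lt_le_trans ltr01)// ler_ln ?posrE ?exprn_gt0 ?(lt_le_trans ltr01)//.
  exact: ltW.
(* The hypothesis [1 <= ln L] absorbs the 1 in [1 + 4 * ln L]. *)
have h : (trunc_log 2 d).+1%:R <= 5 * ln L by lra.
apply: (@le_trans _ _ (5 * ln L * L)); first by apply: ler_wpM2r => //; lra.
have -> : 5 * ln L * L = 5 / a * (a * L * ln L).
  by field; rewrite gt_eqF.
by rewrite [leRHS]mulrDl -[leLHS]add0r lerD ?mulr_ge0// ler_wpM2l// divr_ge0// ltW.
Qed.

(** The constant adds [4 * 3 * (5 + 5 / a)] from the logarithms, [4 * 2] from the halvings, and 1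
    from rounding up in each of [K <= N] phases. *)
Lemma sum_phase_length_le a N (d K : nat) : 0 < a -> (0 < d)%N -> K%:R <= N ->
  0 <= ln N -> K%:R * ln N <= (5 + 5 / a) * d%:R ->
  (\sum_(k < K) phase_length N d%:R (d %/ 2 ^ k))%:R <=
  (12 * (5 + 5 / a) + 9) * N.
Proof.
move=> a0 d0 KN lnN KL.
have N0 : 0 <= N by apply: le_trans KN.
have D0 : (0 : R) < d%:R by rewrite ltr0n.
have r0 : 0 <= 4 * N / d%:R by rewrite divr_ge0 ?mulr_ge0.
rewrite natr_sum.
apply: (@le_trans _ _ (\sum_(k < K) (4 * N / d%:R * (3 * ln N + (d %/ 2 ^ k)%:R) + 1))).
  apply: ler_sum => k _; rewrite /phase_length -natr1 lerD2r truncn_le//.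
  by rewrite mulr_ge0// addr_ge0// mulr_ge0.
rewrite big_split/= -mulr_sumr big_split/= !sumr_const card_ord -natr_sum.
rewrite -[3 * ln N *+ K]mulr_natl.
have halves : (\sum_(k < K) d %/ 2 ^ k)%:R <= 2 * d%:R :> R.
  by rewrite -natrM ler_nat; apply: leq_trans (sum_halvings d K); exact: leq_addr.
apply: (@le_trans _ _ (4 * N / d%:R * (3 * ((5 + 5 / a) * d%:R) + 2 * d%:R) + N)).
  apply: lerD => //; apply: ler_wpM2l => //; apply: lerD => //; rewrite mulrCA ler_wpM2l//.
rewrite le_eqVlt; apply/orP; left; apply/eqP; field.
by rewrite (gt_eqF a0) (gt_eqF D0).
Qed.
End Estimates.

(** * The cover time in terms of loads *)

Section CoverTime.
Context {R : realType} {V : finType}.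

Lemma sum_load (t : nat -> trajectory V) m : (\sum_v load t m v)%N = m.
Proof.
rewrite exchange_big/= -[RHS]card_ord -sum1_card; apply: eq_bigr => i _.
by rewrite (bigD1 (destination (t i)))//= eqxx big1// => v /negPf; rewrite eq_sym => ->.
Qed.

Lemma card_le_cover_time (t : nat -> trajectory V) :
  ((#|V|%:R)%:E <= cover_time R t)%E.
Proof.
apply: le_ereal_inf_tmp => _ [m covered <-].
rewrite lee_fin ler_nat -(sum_load t m) -sum1_card.
by apply: leq_sum.
Qed.

Lemma cover_time_leP (t : nat -> trajectory V) (x : R) : 0 <= x ->
  (cover_time R t <= x%:E)%E <->
  forall v, (1 <= load t (Num.truncn x) v)%N.
Proof.
move=> x0; split=> [le_x|covered]; last first.
  apply: (@le_trans _ _ ((Num.truncn x)%:R)%:E); last by rewrite lee_fin truncn_le.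
  by apply: ereal_inf_lbound; exists (Num.truncn x).
(* Loads never decrease, so otherwise every covering number of balls is at least
   [(Num.truncn x).+1 > x], and so is the infimum. *)
apply: contrapT => uncov.
have : (((Num.truncn x).+1%:R)%:E <= cover_time R t)%E.
  apply: le_ereal_inf_tmp => _ [m covered <-]; rewrite lee_fin ler_nat ltnNge.
  apply/negP => mx; apply: uncov => v.
  exact: leq_trans (covered v) (load_le _ _ mx).
by move=> /le_trans/(_ le_x); rewrite lee_fin leNgt truncnS_gt.
Qed.
End CoverTime.

Theorem theorem1p4 (R : realType) (a : R) (a_gt0 : 0 < a) :
  exists (c C : R) (n0 : nat), 0 < c /\ 0 < C /\
    forall (V : finType) (e : rel V) (d : nat),
      symmetric e -> irreflexive e -> regular e d ->
      (n0 <= #|V|)%N ->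
      a * ln #|V|%:R * ln (ln #|V|%:R) <= d%:R ->
    forall (disp : measure_display) (Omega : measurableType disp)
           (P : probability Omega R) (W : nat -> Omega -> trajectory V),
      local_search_allocation e P W ->
      ((1 - #|V|%:R^-1)%:E <=
       P [set omega | ((c * #|V|%:R)%:E <=
                       cover_time R (fun i => W i omega) <=
                       (C * #|V|%:R)%:E)%E])%E.
Proof.
pose C : R := 12 * (5 + 5 / a) + 9.
have C0 : 0 < C by rewrite /C addr_gt0// mulr_gt0// addr_gt0// divr_gt0.
(* The lower bound holds with [c = 1]; [n0] exceeds [expR (expR 1)], which gives
   [1 <= ln (ln N)]. *)
exists 1, C, (Num.truncn (expR (expR 1) : R)).+1; do 2!split=> //.
move=> V e d e_sym _ e_reg n_ge d_ge disp Omega P W alloc.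
set N : R := #|V|%:R in d_ge *; rewrite mul1r.
have N_ge : expR (expR 1) <= N.
  by apply: ltW; apply: lt_le_trans (truncnS_gt _) _; rewrite ler_nat.
have N0 : 0 < N by apply: lt_le_trans N_ge; exact: expR_gt0.
have lnN : expR 1 <= ln N by rewrite -[expR 1]expRK ler_ln// posrE expR_gt0.
have lnN1 : 1 <= ln N by apply: le_trans lnN; have := expR_ge1Dx (1 : R); lra.
have lnN0 : 0 < ln N by apply: lt_le_trans lnN1.
have lnlnN : 1 <= ln (ln N).
  by rewrite -[1 in leLHS]expRK ler_ln// posrE expR_gt0.
have d0 : (0 < d)%N.
  rewrite -(ltr_nat R); apply: lt_le_trans d_ge.
  by rewrite !mulr_gt0// (lt_le_trans ltr01).
have D0 : (0 : R) < d%:R by rewrite ltr0n.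
have dV : (d <= #|V|)%N.
  by case: (regular_le_card e_reg) => // V0; move: N0; rewrite /N V0 ltxx.
(* The number of halvings that bring [d] down to 0. *)
pose K := (trunc_log 2 d).+1.
(* Indeed [K <= 2 ^ (K - 1) <= d <= #|V|]. *)
have KV : (K <= #|V|)%N.
  apply: leq_trans dV; apply: leq_trans (trunc_logP (ltnSn 1) d0).
  exact: ltn_expl.
pose T := (\sum_(k < K) phase_length N d%:R (d %/ 2 ^ k))%N.
have CN0 : 0 <= C * N by rewrite mulr_ge0 ?ltW.
have TC : (T <= Num.truncn (C * N))%N.
  rewrite truncn_ge_nat//; apply: sum_phase_length_le => //.
  - by rewrite ler_nat.
  - exact: ltW.
  - exact: log_phases_le.
set E := [set omega | _].
have EE : E = [set omega | forall v, (1 <= load (W^~ omega) (Num.truncn (C * N)) v)%N].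
  apply/seteqP; split=> omega.
    by move=> /andP[_ /(cover_time_leP _ CN0)].
  move=> covered; apply/andP; split; first exact: card_le_cover_time.
  exact/(cover_time_leP _ CN0).
have mE : measurable E.
  rewrite EE; apply: (measurable_of_history alloc (m := Num.truncn (C * N))).
  by move=> x y /history_eqP xy h v; rewrite -(load_ext xy).
(* As [d > 0], each [v] has a neighbour [u]; by symmetry an uncovered [v] would be an uncovered
   neighbour of [u]. *)
have sub_E : few_uncovered e W 0 T `<=` E.
  rewrite EE => omega few v; apply: leq_trans (load_le _ _ TC).
  have [u /[!inE] vu] : exists u, u \in [set u | e v u]%SET.
    by apply/card_gt0P; rewrite e_reg.
  rewrite lt0n; apply/negP => v0; have := few u.
  by rewrite leqn0 cards_eq0 => /eqP/setP/(_ v); rewrite !inE e_sym vu v0.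
have mfew : measurable (few_uncovered e W 0 T) by exact: (measurable_few_uncovered alloc).
apply: (@le_trans _ _ (P (few_uncovered e W 0 T))); last first.
  by apply: le_measure; rewrite ?inE.
rewrite -[few_uncovered _ _ _ _]setCK probability_setC; last exact: measurableC.
rewrite EFinB leeB//.
have := phases_failure alloc e_sym e_reg d0 (fun k => phase_length N d%:R (d %/ 2 ^ k)) K.
rewrite divn_small ?trunc_log_ltn// => /le_trans; apply; rewrite lee_fin.
(* At most [N] phases, each failing with probability at most [N ^- 2]. *)
apply: (@le_trans _ _ (\sum_(k < K) (N ^+ 2)^-1)).
  apply: ler_sum => k _; apply: phase_length_bound => //.
  exact: hit_rate_le1 e_reg d0.
rewrite sumr_const card_ord -[leLHS]mulr_natl expr2 invfM mulrA.
rewrite -[leRHS]mul1r ler_wpM2r ?invr_ge0 ?(ltW N0)//.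
by rewrite ler_pdivrMr// mul1r ler_nat.
Qed.
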